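(* Let $X$ be an absolutely continuous nonnegative random variable with probability density function $f$, cumulative distribution function $F$, support $(a,b)$ with $0\le a<b<\infty$, and reversed hazard rate $\phi$. Suppose $E[X\phi(X)]<\infty$ and $E\left[\frac{1}{X\phi(X)}\right]<\infty$. Then $$E\left[\frac{1}{X\phi(X)}\right]\ \ge\ \frac{1}{E[X\phi(X)]},$$ and equality holds if and only if $X$ follows a power distribution, i.e. there is a constant $c>0$ such that $F(x)=\left(\frac{x}{b}\right)^{c}$ for $0<x<b$ (with $F(x)=0$ for $x\le 0$ and $F(x)=1$ for $x\ge b$).
   Context: Saying that $X$ has support $(a,b)$ means that $a=\inf\{t:F(t)>0\}$, $b=\sup\{t:F(t)<1\}$, and $f(t)>0$ for almost every $t\in(a,b)$. The reversed hazard rate of $X$ is $\phi(t)=f(t)/F(t)$ for $t\in(a,b)$. *)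

(* Defs.v *)
From HB Require Import structures.
From mathcomp Require Import all_boot all_order all_algebra.
From mathcomp Require Import all_classical all_reals all_analysis.

Set Implicit Arguments.
Unset Strict Implicit.
Unset Printing Implicit Defensive.

Import Order.TTheory GRing.Theory Num.Theory.
Import numFieldNormedType.Exports.

Local Open Scope classical_set_scope.
Local Open Scope ring_scope.

Definition real_cdf (d : measure_display) (T : measurableType d) (R : realType)
    (P : probability T R) (X : {RV P >-> R}) : R -> R :=
  fun t => fine (cdf X t).

(* Having a density f with respect to Lebesgue measure is what makes X
   absolutely continuous. *)
Definition has_density (d : measure_display) (T : measurableType d)
    (R : realType) (P : probability T R) (X : {RV P >-> R}) (f : R -> R) : Prop :=
  [/\ measurable_fun [set: R] f,
      forall t, 0 <= f t &
      forall A : set R, measurable A ->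
        distribution P X A = (\int[lebesgue_measure]_(t in A) (f t)%:E)%E].

(* The infimum and supremum are taken in \bar R, where they are genuine bounds
   even for unbounded sets (the real-valued sup of an unbounded set is 0). *)
Definition has_support (R : realType) (F f : R -> R) (a b : R) : Prop :=
  [/\ a%:E = ereal_inf [set t%:E | t in [set t | 0 < F t]],
      b%:E = ereal_sup [set t%:E | t in [set t | F t < 1]] &
      {ae lebesgue_measure, forall t : R, a < t < b -> 0 < f t}].

(* Only the values on the support (a, b) matter, since X lies there almost
   surely; elsewhere this is a total extension with the convention x / 0 = 0. *)
Definition reversed_hazard_rate (R : realType) (F f : R -> R) : R -> R :=
  fun t => f t / F t.

Definition power_cdf (R : realType) (b c : R) (F : R -> R) : Prop :=
  [/\ forall x, x <= 0 -> F x = 0,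
      forall x, 0 < x < b -> F x = (x / b) `^ c &
      forall x, b <= x -> F x = 1].

(* Main.v *)
Require Import Defs.
From HB Require Import structures.
From mathcomp Require Import all_boot all_order all_algebra.
From mathcomp Require Import all_classical all_reals all_analysis.
From mathcomp Require Import measurable_realfun.
From mathcomp Require Import ring lra.

Set Implicit Arguments.
Unset Strict Implicit.
Unset Printing Implicit Defensive.

Import Order.TTheory GRing.Theory Num.Theory.
Import numFieldNormedType.Exports.

Local Open Scope classical_set_scope.
Local Open Scope ring_scope.

(* Put u = X phi(X), which is positive almost surely, and m = E[u]. Since
     1/u - 2/m + u/m^2 = (1/u) (1 - u/m)^2 >= 0,
   taking expectations gives E[1/u] - 1/m >= 0, with equality iff u = m almost
   surely. As f > 0 almost everywhere on (a, b), u = m almost surely means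
   f(t) = m F(t) / t for almost every t in (a, b). The right-hand side is
   continuous, so F is differentiable on (a, b) with t F' = m F; hence
   ln F - m ln is constant there and F(b) = 1 gives F(t) = (t/b)^m. This forces
   a = 0 because F(a) = 0. Conversely, F' = f almost everywhere by Lebesgue
   differentiation, so F(t) = (t/b)^c makes u constant. *)

(** * Measurability of inverses and continuity of integrals in the upper bound *)

Lemma measurable_inv (R : realType) : measurable_fun [set: R] (@GRing.inv R).
Proof.
(* The split isolates 0, where the inverse has the default value 0; off 0 it is continuous on an
   open set. *)
rewrite [X in measurable_fun _ X](_ : _ =
    fun x : R => if x == 0 then 0 else x^-1); last first.
  by apply/funext => x; case: eqVneq => [->|//]; rewrite invr0.
apply: measurable_fun_if => //.
- exact: measurable_fun_eqr.
- rewrite setTI; apply: open_continuous_measurable_fun.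
    rewrite [X in open X](_ : _ = [set x | x != 0]); first exact: open_neq.
    by apply/seteqP; split => x /=; [move=> /negbT|move=> /negbTE].
  by move=> x; rewrite inE /= => /negbT; exact: inv_continuous.
Qed.

Lemma measurable_funV d (T : measurableType d) (R : realType) (D : set T)
    (f : T -> R) :
  measurable_fun D f -> measurable_fun D (fun x => (f x)^-1).
Proof. by move=> mf; apply: measurableT_comp mf; exact: measurable_inv. Qed.

(** Absolute continuity of the integral: the increment between [u] and [v] is at most the integral
    of the absolute value of [f] over []u, v]], a set of small measure. *)
Lemma Rintegral_itvNy_continuous (R : realType) (f : R -> R) :
  lebesgue_measure.-integrable setT (EFin \o f) ->
  continuous (fun x => \int[lebesgue_measure]_(t in `]-oo, x]) f t).
Proof.
move=> intf x.
pose F x := \int[lebesgue_measure]_(t in `]-oo, x]) f t.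
apply/cvgrPdist_lt => e e0.
have [d [d0 hd]] := integral_normr_continuous intf e0.
have intS A : measurable A -> lebesgue_measure.-integrable A (EFin \o f).
  by move=> mA; apply: integrableS intf.
have close u v : u <= v -> v - u < d -> `|F v - F u| < e.
  move=> uv vud; rewrite /F Rintegral_itvB ?bnd_simp//; last exact: intS.
  have uvd : (lebesgue_measure `]u, v] < d%:E)%E.
    by rewrite lebesgue_measure_itv/=; case: ifP => _; rewrite lte_fin.
  apply: le_lt_trans (hd _ (measurable_itv _) uvd).
  by apply: le_normr_Rintegral => //; exact: intS.
near=> y.
have xyd : `|x - y| < d by near: y; exists d.
have [xy|/ltW yx] := leP x y; last first.
  by apply: close => //; exact: le_lt_trans (ler_norm _) xyd.
rewrite distrC; apply: close => //.
by rewrite distrC in xyd; exact: le_lt_trans (ler_norm _) xyd.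
Unshelve. all: by end_near. Qed.

(** * The expectation of the inverse of an almost surely positive function *)

Lemma inv_expectation_ineq d (T : measurableType d) (R : realType)
    (P : probability T R) (u : T -> R) :
  measurable_fun setT u -> {ae P, forall w, 0 < u w} ->
  ('E_P[u] < +oo)%E -> ('E_P[fun w => (u w)^-1%R] < +oo)%E ->
  (('E_P[u])^-1 <= 'E_P[fun w => (u w)^-1%R])%E /\
  ('E_P[fun w => (u w)^-1%R] = ('E_P[u])^-1 <->
   exists c : R, (0 < c)%R /\ {ae P, forall w, u w = c})%E.
Proof.
move=> mu u0 Eu Ev; set v := fun w => (u w)^-1.
have mv : measurable_fun setT v by exact: measurable_funV.
have v0 : {ae P, forall w, 0 < v w}.
  by apply: filterS u0 => w; rewrite invr_gt0.
(* Integrability concerns the absolute value of [g], which agrees with [g] almost surely. *)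
have intP (g : T -> R) : measurable_fun setT g -> {ae P, forall w, 0 < g w} ->
    ('E_P[g] < +oo)%E -> P.-integrable setT (EFin \o g).
  move=> mg g0; rewrite unlock => Eg; apply/integrableP; split.
    exact/measurable_EFinP.
  rewrite (@ae_eq_integral _ _ _ P setT (EFin \o g))//.
  - by apply/measurable_EFinP; apply: measurableT_comp.
  - exact/measurable_EFinP.
  - by apply: filterS g0 => w /= + _ => /ltW g0; rewrite ger0_norm.
have intu := intP _ mu u0 Eu; have intv := intP _ mv v0 Ev.
have finu : 'E_P[u]%E \is a fin_num by rewrite unlock; exact: integrable_fin_num.
have finv : 'E_P[v]%E \is a fin_num by rewrite unlock; exact: integrable_fin_num.
set m := fine 'E_P[u]%E; set k := fine 'E_P[v]%E.
have Em : 'E_P[u]%E = m%:E by rewrite fineK.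
have Ek : 'E_P[v]%E = k%:E by rewrite fineK.
(* Signs are known only almost surely. The absolute value makes the integrand nonnegative everywhere
   and gives access to the criterion that a zero integral forces the function to vanish almost
   everywhere. *)
have absE (g : T -> R) : measurable_fun setT g -> {ae P, forall w, 0 <= g w} ->
    ('E_P[g] = \int[P]_w `|(g w)%:E|)%E.
  move=> mg g0; rewrite unlock; apply: ae_eq_integral => //.
  - exact/measurable_EFinP.
  - by apply/measurable_EFinP; apply: measurableT_comp.
  - by apply: filterS g0 => w /= + _ => {}g0; rewrite ger0_norm.
have m0 : 0 < m.
  have u0' : {ae P, forall w, 0 <= u w} by apply: filterS u0 => w /ltW.
  rewrite lt_neqAle; apply/andP; split; last first.
    by rewrite -lee_fin -Em absE// integral_ge0.
  (* If [m] were 0, [u] would be almost surely both zero and positive, so the whole space would be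
     null. *)
  apply/negP => /eqP m0; move: Em; rewrite -m0 absE//.
  have /ae_eq_integral_abs h : measurable_fun setT (EFin \o u).
    exact/measurable_EFinP.
  move=> /h => {}h; have : {ae P, forall w : T, False}.
    by apply: filterS2 u0 (h measurableT) => w /= + /(_ I)[] => /lt0r_neq0/eqP.
  move=> [N [mN N0 subN]]; move: (probability_setT P).
  have -> : setT = N by apply/seteqP; split => // w _; apply: subN.
  by rewrite N0 => /eqP; rewrite eq_sym onee_eq0.
(* In this expanded form [r] is linear in [v] and [u], which yields its expectation; the factored
   form [rE] yields its sign and its zeros. *)
pose r w := v w - 2 / m + u w / m ^+ 2.
have mr : measurable_fun setT r.
  apply: measurable_funD; last exact: measurable_funM.
  by apply: measurable_funB.
have rE w : 0 < u w -> r w = v w * (1 - u w / m) ^+ 2.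
  by move=> uw; rewrite /r /v; field; rewrite !gt_eqF.
have r0 : {ae P, forall w, 0 <= r w}.
  by apply: filterS u0 => w uw; rewrite rE// mulr_ge0 ?sqr_ge0// invr_ge0 ltW.
have Er : 'E_P[r]%E = (k - m^-1)%:E.
  have -> : r = (v \- cst (2 / m)) \+ (m ^- 2 \o* u) by [].
  have Lu : u \in Lfun P 1 by exact/Lfun1_integrable.
  have Lv : v \in Lfun P 1 by exact/Lfun1_integrable.
  have Lc : cst (2 / m) \in Lfun P 1 by exact: Lfun_cst.
  have LZ : (m ^- 2 \o* u) \in Lfun P 1.
    apply/Lfun1_integrable.
    exact: eq_integrable (integrableZr measurableT (m ^- 2) intu).
  have LB : v \- cst (2 / m) \in Lfun P 1.
    move/Lfun1_integrable in Lc; apply/Lfun1_integrable.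
    exact: eq_integrable (integrableB measurableT intv Lc).
  rewrite expectationD// expectationB// expectation_cst expectationZl// Em Ek.
  by rewrite -EFinB -EFinM -EFinD; congr EFin; field; rewrite gt_eqF.
rewrite Em inver gt_eqF// -/v Ek lee_fin -subr_ge0.
have Er0 := absE _ mr r0; split.
  by rewrite -lee_fin -Er Er0 integral_ge0.
(* Equality means that [r] has zero expectation, hence vanishes almost surely; as [v] is positive,
   the square must vanish. *)
have m_ae : (k = m^-1) <-> {ae P, forall w, u w = m}.
  have /ae_eq_integral_abs h : measurable_fun setT (EFin \o r).
    exact/measurable_EFinP.
  split=> [km|um].
    move: Er0; rewrite Er km subrr => /esym/h => {}h.
    apply: filterS2 u0 (h measurableT) => w uw /(_ I) [] /eqP; rewrite rE//.
    rewrite mulf_eq0 invr_eq0 gt_eqF//= sqrf_eq0 subr_eq0 => /eqP um.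
    by rewrite -[LHS](divfK (lt0r_neq0 m0)) -um mul1r.
  apply/eqP; rewrite -subr_eq0 -eqe -Er Er0; apply/eqP/h => //.
  apply: filterS2 u0 um => w uw umw _ /=.
  by rewrite rE// umw divff ?gt_eqF// subrr expr0n/= mulr0.
split=> [[] /m_ae ?|[c [c0 uc]]]; first by exists m.
(* An almost sure constant value of [u] can only be its mean. *)
have mc : m = c.
  apply: EFin_inj; rewrite -Em -(expectation_cst P c) unlock.
  apply: ae_eq_integral => //.
  - exact/measurable_EFinP.
  - exact/measurable_EFinP.
  by apply: filterS uc => w /= ->.
by congr EFin; apply/m_ae; rewrite mc.
Qed.

(** * The equation [t F' = c F] and power functions *)

Lemma euler_ode_powR (R : realType) (F : R -> R) (c x y : R) :
  0 < x -> x < y -> continuous F -> {in `[x, y], forall t, 0 < F t} ->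
  {in `]x, y[, forall t : R, is_derive t 1 F (c * F t / t)} ->
  F x = F y * (x / y) `^ c.
Proof.
move=> x0 xy cF F0 dF; have y0 := lt_trans x0 xy.
pose h : R -> R := (@ln R \o F) - c *: @ln R.
have hE t : h t = ln (F t) - c * ln t by [].
have itv_gt0 t : t \in `[x, y] -> 0 < t.
  by rewrite in_itv/= => /andP[xt _]; exact: lt_le_trans xt.
have dh t : t \in `]x, y[ -> is_derive t 1 h 0.
  move=> txy; have txy' : t \in `[x, y] by apply: subset_itv_oo_cc.
  have t0 := itv_gt0 _ txy'; have Ft := F0 _ txy'.
  have d1 := is_derive1_comp (is_derive1_ln Ft) (dF _ txy).
  have d2 := is_deriveZ c (is_derive1_ln t0).
  apply: is_derive_eq (is_deriveB d1 d2) _.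
  by rewrite /GRing.scale/=; field; rewrite !gt_eqF.
(* The mean value theorem needs only continuity at the endpoints, so [y] may be a point where [F] is
   not known to be differentiable, such as the right end of the support. *)
have ch : {within `[x, y], continuous h}.
  apply: continuous_in_subspaceT => t; rewrite inE/= => txy.
  apply: (@continuousB _ R^o).
    by apply: continuous_comp; [exact: cF|apply: continuous_ln; exact: F0].
  by apply: (@continuousZr _ R^o); apply: continuous_ln; exact: itv_gt0.
have [z _] := MVT xy dh ch.
rewrite mul0r => /eqP; rewrite subr_eq0 => /eqP hxy.
have Fx : 0 < F x by apply: F0; rewrite in_itv/= lexx ltW.
have Fy : 0 < F y by apply: F0; rewrite in_itv/= lexx andbT ltW.
apply: ln_inj; rewrite ?posrE ?mulr_gt0 ?powR_gt0 ?divr_gt0//.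
rewrite lnM ?posrE ?powR_gt0 ?divr_gt0// ln_powR ln_div ?posrE//.
by move: hxy; rewrite !hE => hxy; lra.
Qed.

(** The derivative of [ln F] at [t] is computed twice, as [l / F t] by the chain rule and as [c / t]
    from the local power form; derivatives are unique. *)
Lemma powR_is_derive_euler (R : realType) (F : R -> R) (b c t l : R) :
  0 < t -> 0 < b -> (\near t, F t = (t / b) `^ c) -> is_derive t 1 F l ->
  t * (l / F t) = c.
Proof.
move=> t0 b0 Fb dF.
have Ft : 0 < F t by rewrite (nbhs_singleton Fb) powR_gt0// divr_gt0.
have d1 := is_derive1_comp (is_derive1_ln Ft) dF.
have d2 : is_derive t 1 (@ln R \o F) (c * t^-1).
  have d := is_deriveB (is_deriveZ c (is_derive1_ln t0))
    (is_derive_cst (c * ln b) t 1).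
  rewrite subr0 in d; apply: near_eq_is_derive d.
  near=> s.
  have s0 : 0 < s by near: s; exact: lt_nbhsr.
  have -> : (@ln R \o F) s = ln ((s / b) `^ c) by congr ln; near: s.
  by rewrite ln_powR ln_div ?posrE// mulrBr.
have : (F t)^-1 * l = c * t^-1.
  exact: etrans (esym (@derive_val _ _ _ _ _ _ _ d1))
    (@derive_val _ _ _ _ _ _ _ d2).
move=> e; rewrite (mulrC l) e; field.
by rewrite gt_eqF.
Unshelve. all: by end_near. Qed.

(** * Distribution functions of variables with a density *)

Section real_cdf.
Context d (T : measurableType d) (R : realType) (P : probability T R).
Context (X : {RV P >-> R}).
Local Notation F := (real_cdf X).

Lemma EFin_real_cdf x : (F x)%:E = cdf X x.
Proof. by rewrite fineK// fin_num_measure. Qed.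

Lemma real_cdf_ge0 x : 0 <= F x.
Proof. by rewrite -lee_fin EFin_real_cdf cdf_ge0. Qed.

Lemma real_cdf_le1 x : F x <= 1.
Proof. by rewrite -lee_fin EFin_real_cdf cdf_le1. Qed.

Lemma real_cdf_nondecreasing x y : x <= y -> F x <= F y.
Proof. by move=> xy; rewrite -lee_fin !EFin_real_cdf cdf_nondecreasing. Qed.

Lemma measurable_real_cdf : measurable_fun [set: R] F.
Proof.
by apply: nondecreasing_measurable => //; exact: real_cdf_nondecreasing.
Qed.

Context (f : R -> R) (Xf : has_density X f).

Lemma measurable_density : measurable_fun [set: R] f.
Proof. by case: Xf. Qed.

Lemma integrable_density : lebesgue_measure.-integrable setT (EFin \o f).
Proof.
case: Xf => mf f0 Pf; apply/integrableP; split; first exact/measurable_EFinP.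
under eq_integral do rewrite /= ger0_norm//.
by rewrite -Pf// probability_setT ltry.
Qed.

Lemma real_cdf_density :
  F = fun x => \int[lebesgue_measure]_(t in `]-oo, x]) f t.
Proof. by apply/funext => x; case: Xf => _ _ Pf; rewrite /real_cdf /cdf Pf. Qed.

Lemma real_cdf_continuous : continuous F.
Proof.
rewrite real_cdf_density.
exact/Rintegral_itvNy_continuous/integrable_density.
Qed.

(** The law of [X] is absolutely continuous, so Lebesgue null sets pull back to null events. *)
Lemma density_ae_comp (Q : set R) :
  {ae lebesgue_measure, forall t, Q t} -> {ae P, forall w, Q (X w)}.
Proof.
move=> [N [mN N0 QN]]; exists (X @^-1` N); split => //.
- by rewrite -[X in measurable X]setTI; exact: measurable_funP.
- case: Xf => mf _ Pf; have := Pf _ mN; rewrite /distribution /pushforward => ->.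
  apply: null_set_integral => //; apply/measurable_EFinP.
  exact: measurable_funS mf.
- by move=> w; exact: QN.
Qed.

(** The integral of [f] over [E] is the probability of hitting [E], here zero, and [f] is
    nonnegative. This transfers almost sure facts about [X] back to Lebesgue measure. *)
Lemma density_eq0_ae (E : set R) : measurable E ->
  {ae P, forall w, ~ E (X w)} ->
  {ae lebesgue_measure, forall t, E t -> f t = 0}.
Proof.
move=> mE XE.
have PE : distribution P X E = 0%E.
  have [N [mN N0 EN]] := XE; apply: subset_measure0 mN _ N0.
    by rewrite -[X in measurable X]setTI; exact: measurable_funP.
  by move=> w Ew; apply: EN => /= /(_ Ew).
case: Xf => mf f0 Pf.
have mfE : measurable_fun E (EFin \o f).
  by apply/measurable_EFinP; exact: measurable_funS mf.
have : (\int[lebesgue_measure]_(t in E) `|(EFin \o f) t|)%E = 0%E.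
  by under eq_integral do rewrite /= ger0_norm//; rewrite -Pf.
move=> /(ae_eq_integral_abs lebesgue_measure mE mfE).
by apply: filterS => t /= + Et => /(_ Et)[].
Qed.

Lemma real_cdf_is_derive_ae :
  {ae lebesgue_measure, forall t : R, is_derive t 1 F (f t)}.
Proof.
have intf := integrable_density.
have : {ae lebesgue_measure, forall t, derivable F t 1 /\ F^`()%classic t = f t}.
  rewrite real_cdf_density; apply: FTC1Ny => [y|]; first exact: integrableS intf.
  by apply: open_integrable_locally => //; exact: openT.
apply: filterS; first exact: (ae_filter_ringOfSetsType lebesgue_measure).
by move=> t [dF <-]; rewrite derive1E; exact: derivableP.
Qed.

(** Replacing [f] by a version [g] leaves the integral [F] unchanged, and the fundamental theorem of
    calculus holds at every continuity point of the integrand. This upgrades almost everywhere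
    information to a derivative at a given point. *)
Lemma real_cdf_is_derive (g : R -> R) (x : R) : measurable_fun [set: R] g ->
  {ae lebesgue_measure, forall t, f t = g t} -> {for x, continuous g} ->
  is_derive x 1 F (g x).
Proof.
move=> mg fg cg; have intf := integrable_density.
have mf : measurable_fun setT (EFin \o f) by exact: measurable_int intf.
have mEg : measurable_fun setT (EFin \o g) by exact/measurable_EFinP.
have intg : lebesgue_measure.-integrable setT (EFin \o g).
  apply/integrableP; split => //; have /integrableP[_] := intf.
  rewrite (@ae_eq_integral _ _ _ lebesgue_measure setT (abse \o (EFin \o g)))//.
  - exact: measurableT_comp.
  - exact: measurableT_comp.
  - apply: filterS fg; first exact: (ae_filter_ringOfSetsType lebesgue_measure).
    by move=> t /= -> _.
have FE : F = fun x => \int[lebesgue_measure]_(t in `]-oo, x]) g t.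
  rewrite real_cdf_density; apply/funext => y; congr fine.
  apply: ae_eq_integral => //; try exact: measurable_funTS.
  apply: filterS fg; first exact: (ae_filter_ringOfSetsType lebesgue_measure).
  by move=> t /= ->.
(* Any upper end beyond [x] would do; it makes [x] an interior point. *)
have xx1 : x < x + 1 by rewrite ltrDl.
have intg1 : lebesgue_measure.-integrable `]-oo, x + 1] (EFin \o g).
  exact: integrableS intg.
have [dF dFE] := continuous_FTC1 xx1 intg1 (ltNyr x) cg.
rewrite FE -dFE derive1E; exact: derivableP.
Qed.

(** * Values of the distribution function at the ends of the support, and where [X] lives *)

Context (a b : R) (suppX : has_support F f a b).

Lemma support_cdf_gt0 t : a < t -> 0 < F t.
Proof.
case: suppX => ainf _ _; rewrite -lte_fin ainf => /ereal_inf_lt[_ [s Fs <-]].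
by rewrite lte_fin => /ltW/real_cdf_nondecreasing; exact: lt_le_trans.
Qed.

(** By continuity a positive value at [a] would persist slightly to the left, against the
    infimum. *)
Lemma support_cdf_left : F a = 0.
Proof.
apply/eqP; rewrite eq_le real_cdf_ge0 andbT leNgt; apply/negP => Fa.
have /cvgr_gt /(_ _ Fa) [e /= e0 Fe] := @real_cdf_continuous a.
have [sa Fs] : a - e / 2 < a /\ 0 < F (a - e / 2).
  split; first by rewrite ltrBlDr ltrDl divr_gt0.
  by apply: Fe; rewrite /= opprB addrC subrK gtr0_norm ?divr_gt0//; lra.
case: suppX => ainf _ _; have : (a%:E <= (a - e / 2)%:E)%E.
  by rewrite ainf; apply: ereal_inf_lbound; exists (a - e / 2).
by rewrite lee_fin leNgt sa.
Qed.

Lemma support_cdf_right : F b = 1.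
Proof.
apply/eqP; rewrite eq_le real_cdf_le1 leNgt; apply/negP => Fb.
have /cvgr_lt /(_ _ Fb) [e /= e0 Fe] := @real_cdf_continuous b.
have [bs Fs] : b < b + e / 2 /\ F (b + e / 2) < 1.
  split; first by rewrite ltrDl divr_gt0.
  apply: Fe; rewrite /= opprD addNKr normrN gtr0_norm ?divr_gt0//; lra.
case: suppX => _ bsup _; have : ((b + e / 2)%:E <= b%:E)%E.
  by rewrite bsup; apply: ereal_sup_ubound; exists (b + e / 2).
by rewrite lee_fin leNgt bs.
Qed.

(** The events [X <= a] and [X > b] have probabilities [F a = 0] and [1 - F b = 0]; the point [b] is
    Lebesgue null. *)
Lemma support_ae : {ae P, forall w, a < X w < b}.
Proof.
have Xa : {ae P, forall w, ~ (X w <= a)}.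
  exists (X @^-1` `]-oo, a]); split.
  - by rewrite -[X in measurable X]setTI; exact: measurable_funP.
  - by have := EFin_real_cdf a; rewrite support_cdf_left => /esym.
  - by move=> w /= /contrapT; rewrite in_itv.
have Xb : {ae P, forall w, ~ (b < X w)}.
  exists (X @^-1` `]b, +oo[); split.
  - by rewrite -[X in measurable X]setTI; exact: measurable_funP.
  - rewrite -[LHS]/(ccdf X b).
    have := cdf_ccdf_1 X b; rewrite -EFin_real_cdf support_cdf_right.
    case: (ccdf X b) => [r| |]//= [] /eqP.
    by rewrite eq_sym addrC -subr_eq subrr => /eqP <-.
  - by move=> w /= /contrapT; rewrite in_itv/= andbT.
have Xneb : {ae P, forall w, X w != b}.
  apply: (@density_ae_comp [set t | t != b]).
  exists [set b]; split => //; first exact: lebesgue_measure_set1.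
  by move=> t /= /negP; rewrite negbK => /eqP.
apply: filterS3 Xa Xb Xneb => w /negP; rewrite -ltNge => -> /negP.
by rewrite -leNgt le_eqVlt => /orP[->|].
Qed.

Lemma support_density_ae : {ae P, forall w, 0 < f (X w)}.
Proof.
case: suppX => _ _ /density_ae_comp fX.
by apply: filterS2 support_ae fX => w Xab; apply.
Qed.

End real_cdf.

Theorem theorem2p2 (d : measure_display) (T : measurableType d) (R : realType)
    (P : probability T R) (X : {RV P >-> R}) (f : R -> R) (a b : R)
    (X_ge0 : {ae P, forall w, 0 <= X w})
    (X_density : has_density X f)
    (le0a : 0 <= a) (ltab : a < b)
    (X_support : has_support (real_cdf X) f a b) :
  let phi := reversed_hazard_rate (real_cdf X) f in
  let EXphi := ('E_P[fun w => (X w * phi (X w))%R])%E in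
  let EinvXphi := ('E_P[fun w => (1 / (X w * phi (X w)))%R])%E in
  (EXphi < +oo)%E -> (EinvXphi < +oo)%E ->
  (EXphi^-1 <= EinvXphi)%E /\
  (EinvXphi = (EXphi^-1)%E <->
   exists c : R, 0 < c /\ power_cdf b c (real_cdf X)).
Proof.
move=> phi EXphi EinvXphi EXphi_fin EinvXphi_fin.
set F := real_cdf X in phi EXphi EinvXphi EXphi_fin EinvXphi_fin *.
have mF : measurable_fun [set: R] F by exact: measurable_real_cdf.
have mf := measurable_density X_density.
have cF : continuous F := real_cdf_continuous X_density.
have F_gt0 t : a < t -> 0 < F t := support_cdf_gt0 X_support (t := t).
have Fa0 : F a = 0 := support_cdf_left X_density X_support.
have Fb1 : F b = 1 := support_cdf_right X_density X_support.
have mphi : measurable_fun [set: R] phi.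
  by apply: measurable_funM => //; exact: measurable_funV.
have mtphi : measurable_fun [set: R] (fun t => t * phi t).
  exact: measurable_funM.
pose u w := X w * phi (X w).
have mu : measurable_fun [set: T] u by exact: measurableT_comp mtphi _.
have u0 : {ae P, forall w, 0 < u w}.
  have fX := support_density_ae X_density X_support.
  apply: filterS2 fX (support_ae X_density X_support) => w fX /andP[aX _].
  by rewrite mulr_gt0 ?divr_gt0 ?F_gt0// (le_lt_trans le0a).
have EinvE : EinvXphi = ('E_P[fun w => (u w)^-1%R])%E.
  by congr expectation; apply/funext => w; rewrite div1r.
rewrite EinvE in EinvXphi_fin *.
have [ineq eqv] := inv_expectation_ineq mu u0 EXphi_fin EinvXphi_fin.
split=> //; apply: (iff_trans eqv).
(* What remains is to match almost sure constancy of [u] with the power form of [F]; the constant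
   value and the exponent are the same [c]. *)
split=> -[c [c0]] => [uc|pc]; exists c; split => //.
- have tphi_ae : {ae lebesgue_measure, forall t, a < t < b -> t * phi t = c}.
    (* [X] almost surely avoids this exceptional set, so [f] vanishes almost everywhere on it, while
       [f] is positive almost everywhere on the support. *)
    pose E := `]a, b[ `&` (fun t => t * phi t) @^-1` (~` [set c]).
    have mE : measurable E.
      apply: measurableI => //; rewrite -[X in measurable X]setTI.
      by apply: mtphi => //; exact: measurableC.
    have fE0 : {ae lebesgue_measure, forall t, E t -> f t = 0}.
      apply: (density_eq0_ae X_density mE).
      by apply: filterS uc => w uwc [_ /(_ uwc)].
    case: X_support => _ _; apply: filterS2 fE0.
      exact: (ae_filter_ringOfSetsType lebesgue_measure).
    move=> t fE0 fgt0 tab.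
    apply: contrapT => tc; move: (fgt0 tab).
    by rewrite fE0 ?ltxx//; split => //=; rewrite in_itv.
  have dF t : a < t < b -> is_derive t 1 F (c * F t / t).
    (* A version of the density that is continuous inside the support; outside it copies [f], so the
       two need comparison only on [(a, b)]. *)
    pose g t := if (a < t) && (t < b) then c * F t / t else f t.
    move=> tab; have -> : c * F t / t = g t by rewrite /g tab.
    apply: (real_cdf_is_derive X_density).
    + apply: measurable_fun_ifT => //.
        by apply: measurable_and; exact: measurable_fun_ltr.
      apply: measurable_funM; first exact: measurable_funM.
      exact: measurable_inv.
    + apply: filterS tphi_ae.
        exact: (ae_filter_ringOfSetsType lebesgue_measure).
      move=> s; rewrite /g; case: ifP => // sab /(_ isT) <-.
      rewrite /phi /reversed_hazard_rate; case/andP: sab => as_ sb.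
      by field; rewrite !gt_eqF ?F_gt0// (le_lt_trans le0a).
    + have /andP[at_ tb] := tab.
      have t0 : t != 0 by rewrite gt_eqF// (le_lt_trans le0a).
      have : {for t, continuous (fun s => c * F s / s)}.
        apply: continuousM; last exact: inv_continuous.
        by apply: continuousM; [exact: cvg_cst|exact: cF].
      rewrite /prop_for /continuous_at {2}/g tab; apply: cvg_trans.
      apply: near_eq_cvg; near=> s; rewrite /g ifT//; apply/andP.
      by split; near: s; [exact: lt_nbhsr|exact: lt_nbhsl].
  have FE x : a < x < b -> F x = (x / b) `^ c.
    case/andP=> ax xb; have x0 := le_lt_trans le0a ax.
    rewrite (@euler_ode_powR _ F c x b)// ?Fb1 ?mul1r//.
    + by move=> t; rewrite in_itv/= => /andP[xt _]; apply/F_gt0/(lt_le_trans ax).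
    + move=> t; rewrite in_itv/= => /andP[xt tb]; apply: dF.
      by rewrite tb (lt_trans ax).
  have a0 : a = 0.
    apply/eqP; rewrite eq_le le0a andbT leNgt; apply/negP => a0.
    have ab0 : 0 < (a / b) `^ c by rewrite powR_gt0// divr_gt0// (lt_trans a0).
    have /cvgr_lt Flt := cvg_at_right_filter (cF a).
    rewrite Fa0 in Flt; near a^'+ => s.
    have as_ : a < s by near: s; exact: nbhs_right_gt.
    have sb : s < b by near: s; exact: nbhs_right_lt.
    have : F s < (a / b) `^ c by near: s; exact: Flt.
    rewrite FE ?as_//= ltNge => /negP; apply.
    have b0 : 0 < b := lt_trans a0 ltab.
    apply: ge0_ler_powR; rewrite ?nnegrE ?divr_ge0 ?ler_pM2r ?invr_gt0//; lra.
  split=> x.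
  + move=> x0; apply/eqP.
    by rewrite eq_le real_cdf_ge0 andbT -Fa0 real_cdf_nondecreasing// a0.
  + by move=> x0b; apply: FE; rewrite a0.
  + move=> bx; apply/eqP.
    by rewrite eq_le real_cdf_le1 -Fb1 real_cdf_nondecreasing.
(* Where [F] has derivative [f t], the power form fixes [t * phi t]; the resulting Lebesgue
   statement is then pulled back along [X]. *)
- have dF := real_cdf_is_derive_ae X_density.
  have : {ae lebesgue_measure, forall t, a < t < b -> t * phi t = c}.
    apply: filterS dF; first exact: (ae_filter_ringOfSetsType lebesgue_measure).
    move=> t dF /andP[at_ tb]; have t0 := le_lt_trans le0a at_.
    apply: (@powR_is_derive_euler _ _ b) dF => //; first exact: lt_trans t0 tb.
    case: pc => _ Fpow _; near=> s; apply: Fpow; apply/andP; split; near: s.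
      exact: lt_nbhsr.
    exact: lt_nbhsl.
  move=> /(density_ae_comp X_density).
  by apply: filterS2 (support_ae X_density X_support) => w tab; apply.
Unshelve. all: by end_near. Qed.
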